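(* Let $D>0$, $\kappa\in\mathbb{R}$, $\varepsilon\ge0$, $g\ge0$ be constants, and let $\Phi(u)=-\frac{\varepsilon}{2}u^2-\frac g3u^3+\frac14u^4$. Let $\Delta t>0$ and let $(u_h^n,q_h^n)\in V_h^k\times V_h^k$, $n\ge0$, be a solution of the fully discrete DG scheme $$\Big(\frac{u_h^{n+1}-u_h^n}{\Delta t},\phi\Big)=-A(q_h^{n+1/2},\phi)-\Big(\frac{\Phi(u_h^{n+1})-\Phi(u_h^n)}{u_h^{n+1}-u_h^n},\phi\Big),\qquad (q_h^n,\psi)=A(u_h^n,\psi)$$ for all $\phi,\psi\in V_h^k$, where $q_h^{n+1/2}=\frac12(q_h^{n+1}+q_h^n)$. Then the solution satisfies the energy dissipation law $$\mathcal{E}_h^{n+1}-\mathcal{E}_h^n=-\frac{\|u_h^{n+1}-u_h^n\|^2}{\Delta t},\qquad\text{where}\quad \mathcal{E}_h^n=\int_a^b\Big(\Phi(u_h^n)+\frac12|q_h^n|^2\Big)dx .$$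
   Context: The scheme discretizes the Swift–Hohenberg problem $u_t=-D\kappa^4u-2D\kappa^2u_{xx}-Du_{xxxx}+f(u)$ on $[a,b]$, $f(u)=\varepsilon u+gu^2-u^3=-\Phi'(u)$, with $u=u_{xx}=0$ at $x=a,b$. Mesh: $[a,b]$ is partitioned into cells $I_j=[x_{j-1/2},x_{j+1/2}]$, $j=1,\dots,N$, $x_{1/2}=a$, $x_{N+1/2}=b$, with mesh size $h$. $V_h^k$ is the space of functions that are polynomials of degree at most $k$ on each cell. At interior interfaces, $v^\pm$ are the right/left limits, $\{v\}=(v^-+v^+)/2$, $[v]=v^+-v^-$. $(\cdot,\cdot)$, $\|\cdot\|$ are the $L^2([a,b])$ inner product and norm. The difference quotient of $\Phi$ is understood as the polynomial in the two arguments obtained after cancellation (so it is also defined where $u_h^{n+1}=u_h^n$). The bilinear form is $$A(w,v)=\sqrt D\Big(A^0(w,v)-\kappa^2(w,v)+(w^+v_x^+)_{1/2}-(w^-v_x^-)_{N+1/2}+(w_x^+v^+)_{1/2}-(w_x^-v^-)_{N+1/2}+\frac{\beta_0}{h}(w^+v^+)_{1/2}+\frac{\beta_0}{h}(w^-v^-)_{N+1/2}\Big),$$ where $$A^0(w,v)=\sum_{j=1}^N\int_{I_j}w_xv_x\,dx+\sum_{j=1}^{N-1}\big(\{w_x\}[v]+[w]\{v_x\}\big)_{j+1/2},$$ and $\beta_0$ is a fixed real boundary flux parameter (chosen with $|\beta_0|\ge C$ for some constant $C>0$, e.g. $C=3$, if $k=1$, and $\beta_0=0$ if $k\ge2$).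 *)

(* Defs.v *)
From mathcomp Require Import all_boot all_order all_algebra.
From mathcomp Require Import all_classical all_reals all_analysis.
From mathcomp Require Import ring.

Set Implicit Arguments.
Unset Strict Implicit.
Unset Printing Implicit Defensive.

Import Order.TTheory GRing.Theory Num.Theory.
Import numFieldNormedType.Exports.

Local Open Scope classical_set_scope.
Local Open Scope ring_scope.

(* [node i] is x_{i+1/2}: the cells are [node j, node j.+1] for j < ncells, and
   the values of [node] beyond [ncells] are irrelevant. *)
Record mesh (R : realType) (a b : R) := Mesh {
  ncells : nat;
  node : nat -> R;
  ncells_gt0 : (0 < ncells)%N;
  node_first : node 0 = a;
  node_last : node ncells = b;
  node_lt : forall j, (j < ncells)%N -> node j < node j.+1 }.

Definition mesh_width (R : realType) (a b : R) (M : mesh a b) : R :=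
  \big[Num.max/0]_(j < ncells M) (node M j.+1 - node M j).

(* The polynomial is prescribed on the open cell only: at an interface an
   element of V_h^k is double valued and only its one-sided limits, defined
   below, are used. *)
Definition dg_space (R : realType) (a b : R) (M : mesh a b) (k : nat) :
    set (R -> R) :=
  [set v | forall j, (j < ncells M)%N ->
     exists2 p : {poly R}, (size p <= k.+1)%N &
       forall y, node M j < y < node M j.+1 -> v y = p.[y]].

Definition L2inner (R : realType) (a b : R) (w v : R -> R) : R :=
  \int[@lebesgue_measure R]_(y in `[a, b]) (w y * v y).

Definition L2norm (R : realType) (a b : R) (v : R -> R) : R :=
  Num.sqrt (L2inner a b v v).

Definition trace_right (R : realType) (v : R -> R) (y : R) : R :=
  lim (v @ y^'+).

Definition trace_left (R : realType) (v : R -> R) (y : R) : R :=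
  lim (v @ y^'-).

Definition average (R : realType) (v : R -> R) (y : R) : R :=
  (trace_left v y + trace_right v y) / 2.

Definition jump (R : realType) (v : R -> R) (y : R) : R :=
  trace_right v y - trace_left v y.

(* derive1 v is the piecewise derivative: it is used only inside the cells and
   through its one-sided limits. *)
Definition form_A0 (R : realType) (a b : R) (M : mesh a b) (w v : R -> R) : R :=
  \sum_(0 <= j < ncells M)
    (\int[@lebesgue_measure R]_(y in `]node M j, node M j.+1[)
       (derive1 w y * derive1 v y)) +
  \sum_(1 <= j < ncells M)
    (average (derive1 w) (node M j) * jump v (node M j) +
     jump w (node M j) * average (derive1 v) (node M j)).

Definition form_A (R : realType) (a b : R) (M : mesh a b) (D kappa beta0 : R)
    (w v : R -> R) : R :=
  Num.sqrt D *
  (form_A0 M w v - kappa ^+ 2 * L2inner a b w v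
   + trace_right w a * trace_right (derive1 v) a
   - trace_left w b * trace_left (derive1 v) b
   + trace_right (derive1 w) a * trace_right v a
   - trace_left (derive1 w) b * trace_left v b
   + beta0 / mesh_width M * (trace_right w a * trace_right v a)
   + beta0 / mesh_width M * (trace_left w b * trace_left v b)).

Definition Phi (R : realType) (eps g s : R) : R :=
  - (eps / 2) * s ^+ 2 - g / 3 * s ^+ 3 + 1 / 4 * s ^+ 4.

(* (Phi s - Phi t) / (s - t) after cancellation of s - t, see [Phi_quotE]. *)
Definition Phi_quot (R : realType) (eps g s t : R) : R :=
  - (eps / 2) * (s + t) - g / 3 * (s ^+ 2 + s * t + t ^+ 2)
  + 1 / 4 * (s ^+ 3 + s ^+ 2 * t + s * t ^+ 2 + t ^+ 3).

Lemma Phi_quotE (R : realType) (eps g s t : R) :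
  Phi_quot eps g s t * (s - t) = Phi eps g s - Phi eps g t.
Proof. by rewrite /Phi_quot /Phi; ring. Qed.

Definition energy (R : realType) (a b eps g : R) (u q : R -> R) : R :=
  \int[@lebesgue_measure R]_(y in `[a, b])
    (Phi eps g (u y) + 1 / 2 * `|q y| ^+ 2).

(* Main.v *)
(* Test the scheme with [d = u n.+1 - u n].  Since [A] is symmetric and linear in
   its first argument on piecewise polynomials, and [d] and
   [r = (q n.+1 + q n) / 2] are in the DG space, the auxiliary equation gives
   [A(r, d) = A(u n.+1, r) - A(u n, r) = (q n.+1 - q n, r)], which is half the
   increment of [|q|^2]; the difference quotient times [d] telescopes to the
   increment of [Phi]. *)
Require Import Defs.
From mathcomp Require Import all_boot all_order all_algebra.
From mathcomp Require Import all_classical all_reals all_analysis.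
From mathcomp Require Import measurable_realfun ring.

Import Order.TTheory GRing.Theory Num.Theory.
Import numFieldNormedType.Exports.

Local Open Scope classical_set_scope.
Local Open Scope ring_scope.

(** Unlike [dg_space], no degree bound: the class is closed under products, so it contains the
    integrands $\Phi(u_h^n)$ and $|q_h^n|^2$, which may leave $V_h^k$. *)
Definition piecewise_poly {R : realType} {a b : R} (M : mesh a b)
    (v : R -> R) : Prop :=
  forall j, (j < ncells M)%N -> exists p : {poly R},
    forall y, node M j < y < node M j.+1 -> v y = p.[y].

(** * Closure, traces and derivatives of piecewise polynomials *)

Section PiecewisePoly.
Context {R : realType} {a b : R} {M : mesh a b}.
Implicit Types v w : R -> R.

Lemma piecewise_poly_dg k v : dg_space M k v -> piecewise_poly M v.
Proof. by move=> + j jN => /(_ j jN)[p _ vp]; exists p. Qed.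

Lemma piecewise_poly_cst c : piecewise_poly M (fun=> c).
Proof. by move=> j _; exists c%:P => y _; rewrite hornerC. Qed.

Lemma piecewise_polyD v w : piecewise_poly M v -> piecewise_poly M w ->
  piecewise_poly M (fun y => v y + w y).
Proof.
move=> hv hw j jN; have [p vp] := hv j jN; have [r wr] := hw j jN.
by exists (p + r) => y yj; rewrite hornerD vp// wr.
Qed.

Lemma piecewise_polyM v w : piecewise_poly M v -> piecewise_poly M w ->
  piecewise_poly M (fun y => v y * w y).
Proof.
move=> hv hw j jN; have [p vp] := hv j jN; have [r wr] := hw j jN.
by exists (p * r) => y yj; rewrite hornerM vp// wr.
Qed.

Lemma piecewise_polyN v : piecewise_poly M v -> piecewise_poly M (fun y => - v y).
Proof. by move=> hv j /hv[p vp]; exists (- p) => y yj; rewrite hornerN vp. Qed.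

Lemma piecewise_polyX n v : piecewise_poly M v ->
  piecewise_poly M (fun y => v y ^+ n).
Proof. by move=> hv j /hv[p vp]; exists (p ^+ n) => y yj; rewrite horner_exp vp. Qed.

(** The degree bound is kept here and in [dg_space_mean], because the increment of $u$ and the mean
    of $q$ serve as test functions. *)
Lemma dg_spaceB k v w : dg_space M k v -> dg_space M k w ->
  dg_space M k (fun y => v y - w y).
Proof.
move=> hv hw j jN; have [p sp vp] := hv j jN; have [r sr wr] := hw j jN.
exists (p - r); last by move=> y yj; rewrite hornerD hornerN vp// wr.
by rewrite (leq_trans (size_polyD _ _))// size_polyN geq_max sp sr.
Qed.

Lemma dg_space_mean k v w : dg_space M k v -> dg_space M k w ->
  dg_space M k (fun y => 1 / 2 * (v y + w y)).
Proof.
move=> hv hw j jN; have [p sp vp] := hv j jN; have [r sr wr] := hw j jN.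
exists ((1 / 2) *: (p + r)); last by move=> y yj; rewrite hornerZ hornerD vp// wr.
rewrite (leq_trans (size_scale_leq _ _))//.
by rewrite (leq_trans (size_polyD _ _))// geq_max sp sr.
Qed.

(** A derivative depends only on the germ, and the cell is open, so [v] equals [p] in a
    neighbourhood of [y]. *)
Lemma derive1_cell {v j} {p : {poly R}} :
  (forall y, node M j < y < node M j.+1 -> v y = p.[y]) ->
  forall y, node M j < y < node M j.+1 -> derive1 v y = p^`().[y].
Proof.
move=> vp y yj; rewrite derivE !derive1E; apply: near_eq_derive.
have /near_in_itvoo : y \in `]node M j, node M j.+1[ by rewrite in_itv.
by apply: filterS => z; rewrite in_itv/= => /vp.
Qed.

(** The filter [y^'+] omits the node itself, so the arbitrary value of [v] there is invisible; just
    to its right [v] is [p], which is continuous. *)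
Lemma trace_right_cell v j (p : {poly R}) : (j < ncells M)%N ->
  (forall y, node M j < y < node M j.+1 -> v y = p.[y]) ->
  trace_right v (node M j) = p.[node M j].
Proof.
move=> jN vp; apply/cvg_lim => //.
have : p.[x] @[x --> (node M j)^'+] --> p.[node M j].
  by apply: cvg_at_right_filter; exact: continuous_horner.
apply: cvg_trans; apply: near_eq_cvg.
near=> y; apply/esym/vp/andP; split; near: y.
  exact: nbhs_right_gt.
by apply: nbhs_right_lt; exact: node_lt.
Unshelve. all: by end_near. Qed.

(** The left trace is read at [node M j.+1], the right end of cell [j]; the argument mirrors that of
    the right trace. *)
Lemma trace_left_cell v j (p : {poly R}) : (j < ncells M)%N ->
  (forall y, node M j < y < node M j.+1 -> v y = p.[y]) ->
  trace_left v (node M j.+1) = p.[node M j.+1].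
Proof.
move=> jN vp; apply/cvg_lim => //.
have : p.[x] @[x --> (node M j.+1)^'-] --> p.[node M j.+1].
  by apply: cvg_at_left_filter; exact: continuous_horner.
apply: cvg_trans; apply: near_eq_cvg.
near=> y; apply/esym/vp/andP; split; near: y.
  by apply: nbhs_left_gt; exact: node_lt.
exact: nbhs_left_lt.
Unshelve. all: by end_near. Qed.

Section Traces.
Variables v w : R -> R.
Hypotheses (hv : piecewise_poly M v) (hw : piecewise_poly M w).
Variable j : nat.
Hypothesis jN : (j < ncells M)%N.

Let cellB (p r : {poly R}) :
  (forall y, node M j < y < node M j.+1 -> v y = p.[y]) ->
  (forall y, node M j < y < node M j.+1 -> w y = r.[y]) ->
  forall y, node M j < y < node M j.+1 -> v y - w y = (p - r).[y].
Proof. by move=> vp wr y yj; rewrite vp// wr// hornerD hornerN. Qed.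

Lemma trace_rightB : trace_right (fun y => v y - w y) (node M j) =
  trace_right v (node M j) - trace_right w (node M j).
Proof.
have [p vp] := hv j jN; have [r wr] := hw j jN.
rewrite (trace_right_cell _ _ _ jN (cellB _ _ vp wr)).
by rewrite (trace_right_cell _ _ _ jN vp) (trace_right_cell _ _ _ jN wr) hornerD hornerN.
Qed.

Lemma trace_leftB : trace_left (fun y => v y - w y) (node M j.+1) =
  trace_left v (node M j.+1) - trace_left w (node M j.+1).
Proof.
have [p vp] := hv j jN; have [r wr] := hw j jN.
rewrite (trace_left_cell _ _ _ jN (cellB _ _ vp wr)).
by rewrite (trace_left_cell _ _ _ jN vp) (trace_left_cell _ _ _ jN wr) hornerD hornerN.
Qed.

Lemma trace_right_derive1B :
  trace_right (derive1 (fun y => v y - w y)) (node M j) =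
  trace_right (derive1 v) (node M j) - trace_right (derive1 w) (node M j).
Proof.
have [p vp] := hv j jN; have [r wr] := hw j jN.
rewrite (trace_right_cell _ _ _ jN (derive1_cell (cellB _ _ vp wr))).
rewrite (trace_right_cell _ _ _ jN (derive1_cell vp)).
by rewrite (trace_right_cell _ _ _ jN (derive1_cell wr)) derivB hornerD hornerN.
Qed.

Lemma trace_left_derive1B :
  trace_left (derive1 (fun y => v y - w y)) (node M j.+1) =
  trace_left (derive1 v) (node M j.+1) - trace_left (derive1 w) (node M j.+1).
Proof.
have [p vp] := hv j jN; have [r wr] := hw j jN.
rewrite (trace_left_cell _ _ _ jN (derive1_cell (cellB _ _ vp wr))).
rewrite (trace_left_cell _ _ _ jN (derive1_cell vp)).
by rewrite (trace_left_cell _ _ _ jN (derive1_cell wr)) derivB hornerD hornerN.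
Qed.

Lemma derive1_cellB y : node M j < y < node M j.+1 ->
  derive1 (fun y => v y - w y) y = derive1 v y - derive1 w y.
Proof.
have [p vp] := hv j jN; have [r wr] := hw j jN => yj.
rewrite (derive1_cell (cellB _ _ vp wr))// (derive1_cell vp)// (derive1_cell wr)//.
by rewrite derivB hornerD hornerN.
Qed.

End Traces.

Lemma piecewise_poly_derive1 v : piecewise_poly M v -> piecewise_poly M (derive1 v).
Proof. by move=> hv j /hv[p vp]; exists p^`(); exact: derive1_cell. Qed.

End PiecewisePoly.

(** * Integrability of piecewise polynomials over $[a,b]$ *)

Section Integrability.
Context {R : realType}.
Notation mu := (@lebesgue_measure R).

(** On a disjoint union the integral of $|f|$ is a sum of two finite integrals. *)
Lemma integrable_setU d (T : measurableType d) (m : {measure set T -> \bar R})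
    (A B : set T) (f : T -> \bar R) : measurable A -> measurable B ->
  [disjoint A & B] ->
  m.-integrable A f -> m.-integrable B f -> m.-integrable (A `|` B) f.
Proof.
move=> mA mB AB /integrableP[mfA iA] /integrableP[mfB iB].
have mf := (measurable_funU _ mA mB).2 (conj mfA mfB).
apply/integrableP; split=> //.
rewrite ge0_integral_setU//; first exact: lte_add_pinfty.
exact: measurableT_comp.
Qed.

(** Continuity gives integrability on the compact closure, which restricts to the open interval. *)
Lemma integrable_horner_itvoo (p : {poly R}) (c d : R) :
  mu.-integrable `]c, d[ (EFin \o horner p).
Proof.
apply: (@integrableS _ _ _ mu `[c, d]) => //; first exact: subset_itv_oo_cc.
apply: continuous_compact_integrable; first exact: segment_compact.
by apply: continuous_subspaceT => x; exact: continuous_horner.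
Qed.

Context {a b : R} {M : mesh a b}.

Lemma integrable_cell v j : piecewise_poly M v -> (j < ncells M)%N ->
  mu.-integrable `]node M j, node M j.+1[ (EFin \o v).
Proof.
move=> hv /hv[p vp].
apply: eq_integrable (integrable_horner_itvoo p _ _) => //.
by move=> y; rewrite inE/= in_itv/= => yj; rewrite vp.
Qed.

Lemma node_ge0 j : (j <= ncells M)%N -> node M 0 <= node M j.
Proof.
elim: j => // j IH jN; rewrite (le_trans (IH (ltnW jN)))// ltW//.
exact: node_lt.
Qed.

(** Cells are added one at a time. The values at the nodes are arbitrary, but single points are null
    sets. *)
Lemma integrable_piecewise_poly v : piecewise_poly M v ->
  mu.-integrable `[a, b] (EFin \o v).
Proof.
move=> hv.
suff H j : (j <= ncells M)%N -> mu.-integrable `[node M 0, node M j] (EFin \o v).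
  by have := H _ (leqnn _); rewrite node_first node_last.
elim: j => [_|j IH jN].
  rewrite set_itv1; apply: null_set_integrable => //.
    exact: measurable_fun_set1.
  exact: lebesgue_measure_set1.
(* Two cuts give three disjoint pieces: $[x_0,x_j]$ for the induction hypothesis, the open cell, and
   its right endpoint. *)
rewrite (@itv_bndbnd_setU _ _ _ (BLeft (node M j.+1))) ?bnd_simp ?node_ge0//.
rewrite (@itv_bndbnd_setU _ _ _ (BRight (node M j))) ?bnd_simp ?node_lt ?(node_ge0 _ (ltnW jN))//.
apply: integrable_setU => //.
- exact: measurableU.
- apply/disj_setPS => y /= [[|]]; rewrite !in_itv/=.
    move=> /andP[_ yj] /andP[+ _].
    by rewrite leNgt (le_lt_trans yj)// node_lt.
  by move=> /andP[_ +] /andP[+ _] => /lt_le_trans /[apply]; rewrite ltxx.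
- apply: integrable_setU => //.
  + apply/disj_setPS => y /= []; rewrite !in_itv/=.
    by move=> /andP[_ +] /andP[+ _] => /le_lt_trans /[apply]; rewrite ltxx.
  + exact/IH/ltnW.
  + exact: integrable_cell.
- rewrite set_itv1; apply: null_set_integrable => //.
    exact: measurable_fun_set1.
  exact: lebesgue_measure_set1.
Qed.

Lemma RintegralB_piecewise_poly v w : piecewise_poly M v -> piecewise_poly M w ->
  \int[mu]_(y in `[a, b]) (v y - w y) =
  \int[mu]_(y in `[a, b]) v y - \int[mu]_(y in `[a, b]) w y.
Proof. by move=> hv hw; rewrite RintegralB//; exact: integrable_piecewise_poly. Qed.

End Integrability.

(* [ring] compares its atoms up to conversion and then unfolds limits and
   integrals, so these are first made opaque. *)
Ltac generalize_ring := repeat match goal with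
  | |- context [trace_left ?f ?x] => generalize (trace_left f x)
  | |- context [trace_right ?f ?x] => generalize (trace_right f x)
  | |- context [L2inner ?c ?d ?f ?g] => generalize (L2inner c d f g)
  | |- context [form_A0 ?m ?f ?g] => generalize (form_A0 m f g)
  | |- context [mesh_width ?m] => generalize (mesh_width m)
  | |- context [Num.sqrt ?x] => generalize (Num.sqrt x)
  end; intros; ring.

(** * Symmetry and linearity of the bilinear forms *)

Section FormA.
Context {R : realType} {a b : R} {M : mesh a b}.
Implicit Types v w z : R -> R.

Lemma L2innerC v w : L2inner a b v w = L2inner a b w v.
Proof. by apply: eq_Rintegral => y _; rewrite mulrC. Qed.

Lemma L2innerBl v w z :
  piecewise_poly M v -> piecewise_poly M w -> piecewise_poly M z ->
  L2inner a b (fun y => v y - w y) z = L2inner a b v z - L2inner a b w z.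
Proof.
move=> hv hw hz; rewrite /L2inner -(@RintegralB_piecewise_poly _ _ _ M); last 2 first.
- exact: piecewise_polyM.
- exact: piecewise_polyM.
by apply: eq_Rintegral => y _; rewrite mulrBl.
Qed.

(** Swapping the arguments exchanges the two interface terms $\{w_x\}[v]$ and $[w]\{v_x\}$. *)
Lemma form_A0C v w : form_A0 M v w = form_A0 M w v.
Proof.
rewrite /form_A0; apply: (f_equal2 +%R).
  apply: eq_bigr => j _.
  by apply: eq_Rintegral => y _; rewrite mulrC.
apply: eq_bigr => j _.
set p := average _ _.
by rewrite addrC (mulrC (jump w _)) (mulrC (average _ _) (jump v _)).
Qed.

(** At each endpoint the two flux terms carry the same sign and are exchanged; the $\beta_0$ terms
    are symmetric by themselves. *)
Lemma form_AC D kappa beta0 v w :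
  form_A M D kappa beta0 v w = form_A M D kappa beta0 w v.
Proof. by rewrite /form_A form_A0C L2innerC; generalize_ring. Qed.

Lemma form_A0Bl v w z :
  piecewise_poly M v -> piecewise_poly M w -> piecewise_poly M z ->
  form_A0 M (fun y => v y - w y) z = form_A0 M v z - form_A0 M w z.
Proof.
move=> hv hw hz; rewrite /form_A0 opprD addrACA -!sumrB; apply: (f_equal2 +%R).
  apply: eq_big_nat => j /andP[_ jN].
  rewrite -RintegralB//; last 2 first.
  - by apply: integrable_cell => //; apply: piecewise_polyM; exact: piecewise_poly_derive1.
  - by apply: integrable_cell => //; apply: piecewise_polyM; exact: piecewise_poly_derive1.
  (* The integral runs over the open cell, where all derivatives are those of polynomials. *)
  apply: eq_Rintegral => y; rewrite inE/= in_itv/= => yj.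
  by rewrite (derive1_cellB _ _ hv hw _ jN)// mulrBl.
(* Interfaces are numbered from 1: at [node M j.+1] right traces come from cell [j.+1] and left
   traces from cell [j]. *)
apply: eq_big_nat => -[|j]// /andP[_ jN].
rewrite /average /jump (trace_rightB _ _ hv hw _ jN) (trace_leftB _ _ hv hw _ (ltnW jN)).
rewrite (trace_right_derive1B _ _ hv hw _ jN) (trace_left_derive1B _ _ hv hw _ (ltnW jN)).
by generalize_ring.
Qed.

Lemma form_ABl D kappa beta0 v w z :
  piecewise_poly M v -> piecewise_poly M w -> piecewise_poly M z ->
  form_A M D kappa beta0 (fun y => v y - w y) z =
  form_A M D kappa beta0 v z - form_A M D kappa beta0 w z.
Proof.
move=> hv hw hz; rewrite /form_A form_A0Bl// L2innerBl//.
have N0 := ncells_gt0 M.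
(* The endpoint $b$ must appear as the right end [node M j.+1] of the last cell, whose index is
   [(ncells M).-1]. *)
have NE : (ncells M).-1.+1 = ncells M := prednK N0.
have jN : ((ncells M).-1 < ncells M)%N by rewrite NE.
have -> : trace_right (fun y => v y - w y) a = trace_right v a - trace_right w a.
  by rewrite -(node_first M) (trace_rightB _ _ hv hw _ N0).
have -> : trace_right (derive1 (fun y => v y - w y)) a =
    trace_right (derive1 v) a - trace_right (derive1 w) a.
  by rewrite -(node_first M) (trace_right_derive1B _ _ hv hw _ N0).
have -> : trace_left (fun y => v y - w y) b = trace_left v b - trace_left w b.
  by rewrite -(node_last M) -NE (trace_leftB _ _ hv hw _ jN).
have -> : trace_left (derive1 (fun y => v y - w y)) b =
    trace_left (derive1 v) b - trace_left (derive1 w) b.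
  by rewrite -(node_last M) -NE (trace_left_derive1B _ _ hv hw _ jN).
by generalize_ring.
Qed.

End FormA.

(** * The energy identity *)

Lemma L2norm_sqr {R : realType} (a b : R) v : L2norm a b v ^+ 2 = L2inner a b v v.
Proof. by rewrite sqr_sqrtr// Rintegral_ge0// => y _; rewrite -expr2 sqr_ge0. Qed.

Theorem theorem4p4 (R : realType) (a b : R) (M : mesh a b) (k : nat)
  (D kappa eps g beta0 C dt : R) (u q : nat -> R -> R)
  (hD : 0 < D) (heps : 0 <= eps) (hg : 0 <= g)
  (hC : 0 < C) (hbeta1 : k = 1%N -> C <= `|beta0|)
  (hbeta2 : (2 <= k)%N -> beta0 = 0)
  (hdt : 0 < dt)
  (hu : forall n, dg_space M k (u n))
  (hq : forall n, dg_space M k (q n))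
  (hscheme : forall n (phi : R -> R), dg_space M k phi ->
     L2inner a b (fun y => (u n.+1 y - u n y) / dt) phi =
     - form_A M D kappa beta0 (fun y => 1 / 2 * (q n.+1 y + q n y)) phi
     - L2inner a b (fun y => Phi_quot eps g (u n.+1 y) (u n y)) phi)
  (haux : forall n (psi : R -> R), dg_space M k psi ->
     L2inner a b (q n) psi = form_A M D kappa beta0 (u n) psi) :
  forall n : nat,
    energy a b eps g (u n.+1) (q n.+1) - energy a b eps g (u n) (q n) =
    - (L2norm a b (fun y => u n.+1 y - u n y) ^+ 2 / dt).
Proof.
move=> n.
have pu m : piecewise_poly M (u m) := piecewise_poly_dg _ _ (hu m).
have pq m : piecewise_poly M (q m) := piecewise_poly_dg _ _ (hq m).
pose d y := u n.+1 y - u n y.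
pose r y := 1 / 2 * (q n.+1 y + q n y).
have hd : dg_space M k d := dg_spaceB _ _ _ (hu n.+1) (hu n).
have hr : dg_space M k r := dg_space_mean _ _ _ (hq n.+1) (hq n).
have pd : piecewise_poly M d := piecewise_poly_dg _ _ hd.
have pr : piecewise_poly M r := piecewise_poly_dg _ _ hr.
have pPhi m : piecewise_poly M (fun y => Phi eps g (u m y)).
  by rewrite /Phi; do ?[apply: piecewise_polyD | apply: piecewise_polyN
    | apply: piecewise_polyM | apply: piecewise_polyX
    | exact: piecewise_poly_cst | exact: pu].
have pq2 m : piecewise_poly M (fun y => 1 / 2 * q m y ^+ 2).
  by apply: piecewise_polyM; [exact: piecewise_poly_cst|exact: piecewise_polyX].
have AE : form_A M D kappa beta0 r d =
    \int[@lebesgue_measure R]_(y in `[a, b]) (1 / 2 * q n.+1 y ^+ 2) -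
    \int[@lebesgue_measure R]_(y in `[a, b]) (1 / 2 * q n y ^+ 2).
  (* Symmetry puts [d] first, the slot in which linearity is available and in which [haux] has [u];
     [haux] is then used at both time levels with test function [r]. *)
  rewrite form_AC form_ABl// -!haux// -(@L2innerBl _ _ _ M)//.
  rewrite -(@RintegralB_piecewise_poly _ _ _ M)//.
  (* Pointwise a difference of squares: $(q^{n+1}-q^n)\cdot\frac12(q^{n+1}+q^n)$. *)
  by apply: eq_Rintegral => y _; rewrite /r; field.
have QE : L2inner a b (fun y => Phi_quot eps g (u n.+1 y) (u n y)) d =
    \int[@lebesgue_measure R]_(y in `[a, b]) Phi eps g (u n.+1 y) -
    \int[@lebesgue_measure R]_(y in `[a, b]) Phi eps g (u n y).
  rewrite -(@RintegralB_piecewise_poly _ _ _ M)//.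
  (* The cancelled quotient makes this hold also at points where [d] vanishes. *)
  by apply: eq_Rintegral => y _; rewrite Phi_quotE.
have EE m : energy a b eps g (u m) (q m) =
    \int[@lebesgue_measure R]_(y in `[a, b]) Phi eps g (u m y) +
    \int[@lebesgue_measure R]_(y in `[a, b]) (1 / 2 * q m y ^+ 2).
  rewrite -RintegralD//; last 2 first.
  - exact: integrable_piecewise_poly (pPhi m).
  - exact: integrable_piecewise_poly (pq2 m).
  by apply: eq_Rintegral => y _; rewrite real_normK// num_real.
have := hscheme n d hd; rewrite AE QE.
(* The time-difference term tested with [d] is the dissipation $\|d\|^2/\Delta t$. *)
have -> : L2inner a b (fun y => (u n.+1 y - u n y) / dt) d = L2inner a b d d / dt.
  rewrite /L2inner -RintegralZr//.
    by apply: eq_Rintegral => y _; rewrite mulrAC.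
  by apply: (@integrable_piecewise_poly _ _ _ M); exact: piecewise_polyM.
(* The scheme now equates the dissipation with minus the increments of the $q$ part and the $\Phi$
   part of the energy. *)
by rewrite L2norm_sqr !EE => ->; ring.
Qed.
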